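(* Let $q\ge 3$ be a power of a prime $p$. Each point lying in $PG(2,\mathbb{F}_{q^2})\setminus PG(2,\mathbb{F}_q)$ is a $(q-1)$-fold point of the DGZ curve $\mathcal{C}$.
   Context: Put $D_1(x,y,z)=\begin{vmatrix} x & x^q & x^{q^3}\\ y & y^q & y^{q^3}\\ z & z^q & z^{q^3}\end{vmatrix}$, $D_2(x,y,z)=\begin{vmatrix} x & x^q & x^{q^2}\\ y & y^q & y^{q^2}\\ z & z^q & z^{q^2}\end{vmatrix}$ and $F=D_1/D_2$, which is a homogeneous polynomial of degree $q^3-q^2$ over $\mathbb{F}_q$. The DGZ curve $\mathcal{C}$ is the plane curve over $\overline{\mathbb{F}}_q$ with equation $F(x,y,z)=0$. A point is an $m$-fold point of a plane curve if the curve has multiplicity exactly $m$ there: after moving the point to the origin of an affine chart, the lowest-degree nonzero homogeneous part of the affine equation has degree $m$. *)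

(* Defs.v *)
From HB Require Import structures.
From mathcomp Require Import all_boot all_order all_fingroup all_algebra all_field.
From mathcomp Require Import mpoly.
From mathcomp Require Import ring.

Set Implicit Arguments.
Unset Strict Implicit.
Unset Printing Implicit Defensive.

Import GRing.Theory.
Local Open Scope ring_scope.

Lemma det_mx33 (R : comNzRingType) (A : nat -> nat -> R) :
  \det (\matrix_(i < 3, j < 3) A i j) =
  A 0%N 0%N * (A 1%N 1%N * A 2%N 2%N - A 1%N 2%N * A 2%N 1%N) -
  A 0%N 1%N * (A 1%N 0%N * A 2%N 2%N - A 1%N 2%N * A 2%N 0%N) +
  A 0%N 2%N * (A 1%N 0%N * A 2%N 1%N - A 1%N 1%N * A 2%N 0%N).
Proof.
do !rewrite (expand_det_row _ 0) !big_ord_recl big_ord0 /cofactor.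
rewrite !det_mx00 !mxE /= /bump /=.
ring.
Qed.

Section DGZCurve.
Variable Fq : finFieldType.
Local Notation q := #|Fq|.

(* The determinant with rows (t^(q^a), t^(q^b), t^(q^c)), where t runs over the
   three indeterminates x = 'X_0, y = 'X_1, z = 'X_2. *)
Definition frobenius_det (a b c : nat) : {mpoly Fq[3]} :=
  \det (\matrix_(i < 3, j < 3) ('X_i ^+ (q ^ nth 0%N [:: a; b; c] j))).

Definition D1 : {mpoly Fq[3]} := frobenius_det 0 1 3.
Definition D2 : {mpoly Fq[3]} := frobenius_det 0 1 2.

Lemma mpoly_exprDq (f g : {mpoly Fq[3]}) : (f + g) ^+ q = f ^+ q + g ^+ q.
Proof.
apply: exprDn_pchar; have [p p_pr pF] := finPcharP Fq.
have pR : p \in [pchar {mpoly Fq[3]}].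
  by rewrite inE p_pr -mpolyC_nat (pcharf0 pF) mpolyC0 eqxx.
by rewrite (eq_pnat _ (pcharf_eq pR)) (card_pprimeChar pF) pnatX pnat_id.
Qed.

Lemma mpoly_exprBq (f g : {mpoly Fq[3]}) : (f - g) ^+ q = f ^+ q - g ^+ q.
Proof. by apply/(addIr (g ^+ q)); rewrite -mpoly_exprDq !subrK. Qed.

Lemma D2_dvd_D1 : exists F : {mpoly Fq[3]}, D1 == F * D2.
Proof.
have q_gt0 : (0 < q)%N by apply/card_gt0P; exists 0.
pose t i : {mpoly Fq[3]} := 'X_(inord i).
pose M e i j := t i ^+ (q ^ nth 0%N e j).
have detE a b c : frobenius_det a b c =
    \det (\matrix_(i < 3, j < 3) M [:: a; b; c] i j).
  by congr (\det _); apply/matrixP => i j; rewrite !mxE /M /t inord_val.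
(* The monic q-linearised polynomial L3 of q-degree 3 vanishes at x, y and z,
   which expresses the q^3-powers through the lower ones. *)
pose a := t 0%N ^+ q.-1; pose L1 u := u ^+ q - a * u.
pose b := L1 (t 1%N) ^+ q.-1; pose L2 u := L1 u ^+ q - b * L1 u.
pose c := L2 (t 2%N) ^+ q.-1; pose L3 u := L2 u ^+ q - c * L2 u.
have step (v : {mpoly Fq[3]}) : v ^+ q - v ^+ q.-1 * v = 0.
  by rewrite -exprSr prednK // subrr.
have step0 (d v : {mpoly Fq[3]}) : v = 0 -> v ^+ q - d * v = 0.
  by move=> ->; rewrite expr0n gtn_eqF // mulr0 subr0.
have L30 i : (i < 3)%N -> L3 (t i) = 0.
  case: i => [|[|[|//]]] _; last exact: step; apply: (step0).
    by apply: (step0); apply: step.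
  exact: step.
have tq3 i : (i < 3)%N -> t i ^+ (q ^ 3) =
    (a ^+ q ^+ q + b ^+ q + c) * t i ^+ (q ^ 2)
    - (b ^+ q * a ^+ q + c * (a ^+ q + b)) * t i ^+ q + c * b * a * t i.
  move=> /L30; rewrite /L3 /L2 /L1 !(mpoly_exprBq, exprMn) => e.
  rewrite !expnS expn0 muln1 !exprM; apply/eqP; rewrite -subr_eq0 -e.
  by apply/eqP; ring.
exists (a ^+ q ^+ q + b ^+ q + c).
rewrite /D1 /D2 !detE !det_mx33 /M /= !tq3 // !expn0 !expn1 !expr1.
by apply/eqP; ring.
Qed.

Lemma D2_neq0 : D2 != 0.
Proof.
have q_gt1 : (1 < q)%N by apply: finNzRing_gt1.
pose m (s : 'S_3) : 'X_{1..3} := [multinom (q ^ s i)%N | i < 3].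
have D2E : D2 = \sum_(s : 'S_3) (-1) ^+ s *: 'X_[m s].
  apply: eq_bigr => s _; rewrite scaler_sign mulr_sign mpolyXE_id.
  have -> // : \prod_i (\matrix_(i < 3, j < 3)
      'X_i ^+ (q ^ nth 0%N [:: 0; 1; 2]%N j)) i (s i)
    = \prod_(i < 3) 'X_i ^+ m s i :> {mpoly Fq[3]}.
  apply: eq_bigr => i _; rewrite mxE mnmE.
  by case: (s i) => [[|[|[|//]]]].
apply/eqP => /(congr1 (mcoeff (m 1%g))); rewrite D2E mcoeff0 raddf_sum /=.
rewrite (bigD1 1%g) //= big1 ?addr0 => [|s s_neq1]; rewrite mcoeffZ mcoeffX.
  by rewrite eqxx odd_perm1 mulr1 => /eqP; rewrite oner_eq0.
case: eqP => [ms|_]; last by rewrite mulr0.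
case/eqP: s_neq1; apply/permP => i; rewrite perm1; apply/val_inj/eqP => /=.
have /eqP := congr1 (fun u : 'X_{1..3} => u i) ms.
by rewrite !mnmE perm1 eqn_exp2l.
Qed.

(* The exact quotient F = D1 / D2. *)
Definition dgz_poly : {mpoly Fq[3]} := xchoose D2_dvd_D1.

Lemma dgz_polyP : D1 = dgz_poly * D2.
Proof. exact/eqP/(xchooseP D2_dvd_D1). Qed.

End DGZCurve.

(* Points of PG(2, K) are given by nonzero vectors of homogeneous coordinates
   in 'rV[K]_3, and plane projective curves by homogeneous polynomials in
   {mpoly K[3]}. *)

(* The projective point with homogeneous coordinates v lies in PG(2, L), for L a
   subfield of K (embedded by j). *)
Definition rational_over (L K : fieldType) (j : {rmorphism L -> K})
    (v : 'rV[K]_3) : Prop :=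
  exists (c : K) (w : 'rV[L]_3), c != 0 /\ v = c *: map_mx j w.

(* The equation G = 0 in the affine chart X_i = 1 after translating the point v
   (with v_i != 0) to the origin: X_i becomes 1, and each of the other two
   variables X_j becomes v_j / v_i + Y_k, where j = lift i k. *)
Definition local_eq (K : fieldType) (G : {mpoly K[3]}) (v : 'rV[K]_3)
    (i : 'I_3) : {mpoly K[2]} :=
  G \mPo [tuple if unlift i j is Some k
                then (v 0 j / v 0 i)%:MP + 'X_k else 1 | j < 3].

Definition lowest_degree (K : fieldType) (n : nat) (g : {mpoly K[n]})
    (m : nat) : Prop :=
  pihomog mdeg m g != 0 /\ forall d, (d < m)%N -> pihomog mdeg d g = 0.

(* The multiplicity does not depend on the chart; all the standard charts that
   contain the point are quantified over. *)
Definition multiplicity_at (K : fieldType) (G : {mpoly K[3]}) (v : 'rV[K]_3)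
    (m : nat) : Prop :=
  v != 0 /\ forall i : 'I_3, v 0 i != 0 -> lowest_degree (local_eq G v i) m.

(* Main.v *)
(** Normalise P to coordinates a with a_i = 1 and write v = a + Z, with Z the
    local coordinates (Z_i = 0). Taking q-th powers is additive and
    a^(q^2) = a, so with b = a^q
      D1 = det(a + Z, b + Z^q, b + Z^(q^3)) = - det(a, b, Z^q) + higher order,
      D2 = det(a + Z, b + Z^q, a + Z^(q^2)) = - det(a, b, Z) + higher order.
    As P is not F_q-rational, a and b differ, hence (both being 1 at i) are
    independent and these leading forms are nonzero. Lowest degrees are
    additive under products, so F = D1 / D2 has lowest degree q - 1. *)
Require Import Defs.
From mathcomp Require Import all_boot all_order all_algebra all_field.
From mathcomp Require Import mpoly ring zify.

Set Implicit Arguments.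
Unset Strict Implicit.
Unset Printing Implicit Defensive.

Import GRing.Theory.
Local Open Scope ring_scope.

(** * Orders of vanishing at the origin and lowest-degree forms *)

Section Order.
Variables (n : nat) (K : fieldType).
Implicit Types (d e : nat) (f g : {mpoly K[n]}).

(** Membership in the [d]-th power of the ideal of the origin. Zero satisfies it for every [d], so
    error terms can be bounded without knowing whether they vanish. *)
Definition order_ge d f := forall m : 'X_{1..n}, (mdeg m < d)%N -> f@_m = 0.

Lemma order_geW d e f : (d <= e)%N -> order_ge e f -> order_ge d f.
Proof. by move=> le_de fe m lt_md; apply/fe/(leq_trans lt_md). Qed.

Lemma order_geD d f g : order_ge d f -> order_ge d g -> order_ge d (f + g).
Proof. by move=> fd gd m lt_md; rewrite mcoeffD fd ?gd ?addr0. Qed.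

Lemma order_geN d f : order_ge d f -> order_ge d (- f).
Proof. by move=> fd m lt_md; rewrite mcoeffN fd ?oppr0. Qed.

Lemma order_geM d e f g :
  order_ge d f -> order_ge e g -> order_ge (d + e) (f * g).
Proof.
move=> fd ge m lt_m; rewrite mcoeffM big1 // => -[k1 k2] /= /eqP def_m.
have [lt_k1|le_k1] := ltnP (mdeg k1) d; first by rewrite fd ?mul0r.
rewrite [X in _ * X]ge ?mulr0 //.
by have := congr1 mdeg def_m; rewrite mdegD; lia.
Qed.

Lemma dhomog_order_ge d f : f \is d.-homog for mdeg -> order_ge d f.
Proof.
move=> /dhomogP fd m lt_md; apply/memN_msupp_eq0/negP => /fd md.
by rewrite md ltnn in lt_md.
Qed.

Lemma mcoeff_pihomog d f m :
  (pihomog mdeg d f)@_m = if mdeg m == d then f@_m else 0.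
Proof.
rewrite pihomogE raddf_sum /= big_mkcond /= [in RHS](mpolyE f) raddf_sum /=.
case: ifP => md; [apply: eq_bigr => k _|apply: big1 => k _];
  rewrite !mcoeffZ mcoeffX;
  by have [->|_] := eqVneq k m; rewrite ?mulr0 ?if_same ?md.
Qed.

(** The tool for identifying leading forms: exhibit a nonzero form [h] and bound the order of the
    error [r]. *)
Lemma lowest_degree_decomp d h r :
  h \is d.-homog for mdeg -> h != 0 -> order_ge d.+1 r ->
  lowest_degree (h + r) d.
Proof.
move=> hd h0 rd.
have r0 e : (e <= d)%N -> pihomog mdeg e r = 0.
  move=> le_ed; apply/mpolyP => m; rewrite mcoeff_pihomog mcoeff0.
  by case: eqP => // me; rewrite rd // me ltnS.
split=> [|e lt_ed]; first by rewrite pihomogD r0 // addr0 pihomog_dE.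
by rewrite pihomogD r0 1?ltnW // addr0 (pihomog_ne0 _ hd) // gtn_eqF.
Qed.

Lemma lowest_degree_rem d f :
  lowest_degree f d -> order_ge d.+1 (f - pihomog mdeg d f).
Proof.
case=> _ f0 m; rewrite ltnS leq_eqVlt mcoeffB mcoeff_pihomog.
case/orP=> [->|lt_md]; first by rewrite subrr.
rewrite ltn_eqF // subr0.
by have /mpolyP/(_ m) := f0 _ lt_md; rewrite mcoeff_pihomog eqxx mcoeff0.
Qed.

Lemma lowest_degree_ge d f : lowest_degree f d -> order_ge d f.
Proof.
move=> fd; rewrite -[f](subrK (pihomog mdeg d f)).
apply: order_geD; first exact: order_geW (leqnSn d) (lowest_degree_rem fd).
exact/dhomog_order_ge/pihomogP.
Qed.

Lemma lowest_degree_exists f : f != 0 -> exists d, lowest_degree f d.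
Proof.
move=> f0; have exd : exists d, pihomog mdeg d f != 0.
  have /existsP[d fd] : [exists d : 'I_(msize f), pihomog mdeg d f != 0].
    apply: contraNT f0; rewrite negb_exists => /forallP f0.
    rewrite (pihomog_partitionE (leqnn (msize f))) big1 // => d _.
    exact/eqP/negPn/f0.
  by exists d.
exists (ex_minn exd); case: ex_minnP => d fd min_d; split=> // e lt_ed.
by apply: contraTeq lt_ed => /min_d; rewrite leqNgt.
Qed.

Lemma lowest_degree_uniq d e f : lowest_degree f d -> lowest_degree f e -> d = e.
Proof.
move=> [/eqP fd dmin] [/eqP fe emin].
by have [/emin /fd|/dmin /fe|] := ltngtP d e.
Qed.

(** Leading forms multiply, and their product is nonzero because polynomials over a field form a
    domain. *)
Lemma lowest_degreeM d e f g :
  lowest_degree f d -> lowest_degree g e -> lowest_degree (f * g) (d + e).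
Proof.
move=> fd ge; have [[f0 _] [g0 _]] := (fd, ge).
have -> : f * g = pihomog mdeg d f * pihomog mdeg e g +
   ((f - pihomog mdeg d f) * g +
    pihomog mdeg d f * (g - pihomog mdeg e g)) by ring.
apply: lowest_degree_decomp; first by apply: dhomogM; apply: pihomogP.
  by rewrite mulf_neq0.
apply: order_geD.
  by rewrite -addSn; apply: order_geM (lowest_degree_rem fd) (lowest_degree_ge ge).
rewrite -addnS; apply: order_geM (lowest_degree_rem ge).
exact/dhomog_order_ge/pihomogP.
Qed.

(** Handles an exact quotient without a formula for it: [f] is nonzero, so it has some lowest degree
    [k], and [k + e = d] by additivity and uniqueness. *)
Lemma lowest_degree_factor d e f g :
  lowest_degree (f * g) d -> lowest_degree g e -> lowest_degree f (d - e).
Proof.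
move=> fgd ge; have [|k fk] := @lowest_degree_exists f.
  by apply/eqP => f0; case: fgd; rewrite f0 mul0r pihomog0 eqxx.
by rewrite (lowest_degree_uniq fgd (lowest_degreeM fk ge)) addnK.
Qed.

End Order.

(** * Cross products and 3 by 3 determinants *)

Section Cross.
Variable R : comNzRingType.
Implicit Types (u v w : 'I_3 -> R).

(** Indices in ['I_3] add modulo 3, so one cyclic formula gives all three coordinates. *)
Definition cross u v (i : 'I_3) : R :=
  u (i + 1) * v (i + 1 + 1) - u (i + 1 + 1) * v (i + 1).

Definition det3 u v w : R := \sum_i cross u v i * w i.

Lemma eq_det3 u u' v v' w w' :
  u =1 u' -> v =1 v' -> w =1 w' -> det3 u v w = det3 u' v' w'.
Proof.
move=> uu vv ww; apply: eq_bigr => i _.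
by rewrite /cross !uu !vv ww.
Qed.

Let I0 : 'I_3 := inord 0.
Let I1 : 'I_3 := inord 1.
Let I2 : 'I_3 := inord 2.

Lemma det3E u v w : det3 u v w =
  (u I1 * v I2 - u I2 * v I1) * w I0 + (u I2 * v I0 - u I0 * v I2) * w I1 +
  (u I0 * v I1 - u I1 * v I0) * w I2.
Proof.
have e0 : ord0 = I0 by apply: val_inj; rewrite /= inordK.
have e1 : lift ord0 ord0 = I1 by apply: val_inj; rewrite /= inordK.
have e2 : lift ord0 (lift ord0 ord0) = I2 by apply: val_inj; rewrite /= inordK.
have a0 : I0 + 1 = I1 by apply: val_inj; rewrite /= !inordK.
have a1 : I1 + 1 = I2 by apply: val_inj; rewrite /= !inordK.
have a2 : I2 + 1 = I0 by apply: val_inj; rewrite /= !inordK.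
rewrite /det3 !big_ord_recl big_ord0 e2 e1 e0 /cross !(a0, a1, a2).
ring.
Qed.

Lemma det_det3 (u : 'I_3 -> nat -> R) (s : nat -> nat) :
  \det (\matrix_(i < 3, j < 3) u i (s j)) =
  det3 (u^~ (s 0)) (u^~ (s 1)) (u^~ (s 2)).
Proof.
pose A i j := u (inord i) (s j).
transitivity (\det (\matrix_(i < 3, j < 3) A i j)).
  by congr (\det _); apply/matrixP => i j; rewrite !mxE /A inord_val.
rewrite det_mx33 det3E /A -/I0 -/I1 -/I2; ring.
Qed.

(** The constant term [det3 a b a] vanishes. When [y] and [x] are the q-th and q^2-th powers of [z],
    the first summand is the one of smallest degree. *)
Lemma det3_expand_same13 a b x y z :
  det3 (fun i => a i + z i) (fun i => b i + y i) (fun i => a i + x i) =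
  - det3 a b z +
  (- det3 a y z + det3 (fun i => a i + z i) (fun i => b i + y i) x).
Proof. rewrite !det3E; ring. Qed.

Lemma det3_expand_same23 a b x y z :
  det3 (fun i => a i + z i) (fun i => b i + y i) (fun i => b i + x i) =
  - det3 a b y +
  (- det3 z b y + det3 (fun i => a i + z i) (fun i => b i + y i) x).
Proof. rewrite !det3E; ring. Qed.

(* The coordinate of the cross product at i is left out because it is invisible
   in the chart, where Z_i = 0. *)
Lemma cross_eq0 u v i : u i = 1 -> v i = 1 ->
  (forall k, cross u v (lift i k) = 0) -> forall j, u j = v j.
Proof.
move=> ui vi uv0; have i3 : i + 1 + 1 + 1 = i.
  by apply: val_inj; case: i {ui vi uv0} => [[|[|[|]]]].
have uv j : j != i -> cross u v j = 0.
  by rewrite eq_sym => /unlift_some[k -> _]; apply: uv0.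
(* Since [u i = v i = 1], the cross product at [i + 1] and at [i + 1 + 1] is, up to sign, a
   difference of coordinates of [u] and [v]. *)
have /uv : i + 1 != i by case: i {ui vi uv0 i3 uv} => [[|[|[|]]]].
have /uv : i + 1 + 1 != i by case: i {ui vi uv0 i3 uv} => [[|[|[|]]]].
rewrite /cross !i3 ui vi !mulr1 !mul1r => /eqP; rewrite subr_eq0 => /eqP e1.
move/eqP; rewrite subr_eq0 => /eqP e2 j.
have : [|| j == i, j == i + 1 | j == i + 1 + 1].
  by case: i j {ui vi uv0 i3 uv e1 e2} => [[|[|[|]]]] // ? [[|[|[|]]]].
by case/or3P => /eqP->; rewrite ?ui ?vi.
Qed.

End Cross.

Lemma order_ge_det3 (n : nat) (K : fieldType) (d e l : nat)
    (u v w : 'I_3 -> {mpoly K[n]}) :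
  (forall i, order_ge d (u i)) -> (forall i, order_ge e (v i)) ->
  (forall i, order_ge l (w i)) -> order_ge (d + e + l) (det3 u v w).
Proof.
move=> ud ve wl; rewrite det3E.
have cr i j : order_ge (d + e) (u i * v j - u j * v i).
  by apply: order_geD; [|apply: order_geN]; apply: order_geM.
by do !apply: order_geD; apply: order_geM.
Qed.

(** * Leading forms in local coordinates *)

Section LocalCoordinates.
Variables (K : fieldType) (i : 'I_3).

Definition local_coord (j : 'I_3) : {mpoly K[2]} :=
  if unlift i j is Some k then 'X_k else 0.

Lemma local_coordX_homog n j : (0 < n)%N ->
  local_coord j ^+ n \is n.-homog for mdeg.
Proof.
rewrite /local_coord; case: unliftP => [k _|_] n_gt0.
  by rewrite mpolyXn dhomogX /= mdegMn mdeg1 mul1n.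
by rewrite expr0n gtn_eqF // rpred0.
Qed.

Lemma det3_local_homog n (a b : 'I_3 -> K) : (0 < n)%N ->
  det3 (fun j => (a j)%:MP) (fun j => (b j)%:MP)
       (fun j => local_coord j ^+ n) \is n.-homog for mdeg.
Proof.
move=> n_gt0; apply: rpred_sum => j _.
rewrite /cross -!mpolyCM -mpolyCB mul_mpolyC.
exact/rpredZ/local_coordX_homog.
Qed.

(** The coefficient of ['X_k ^+ n] is the cross product coordinate at [lift i k]; if both vanished,
    [a] and [b] would agree. *)
Lemma det3_local_neq0 n (a b : 'I_3 -> K) : (0 < n)%N ->
  a i = 1 -> b i = 1 -> (exists j, a j != b j) ->
  det3 (fun j => (a j)%:MP) (fun j => (b j)%:MP)
       (fun j => local_coord j ^+ n) != 0.
Proof.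
move=> n_gt0 ai bi [j ab]; apply: contraNneq ab => det0; apply/eqP.
apply: (cross_eq0 ai bi) => k.
have /mpolyP/(_ (U_(k) *+ n)%MM) := det0.
(* The summand at [i] drops out, since Z_i = 0 and [n] is positive. *)
rewrite mcoeff0 /det3 (bigD1_ord i) //= {1}/local_coord unlift_none.
rewrite expr0n gtn_eqF // mulr0 add0r raddf_sum /=.
rewrite (bigD1 k) //= big1 => [|l lk];
  rewrite /local_coord liftK /cross -!mpolyCM -mpolyCB mcoeffCM mpolyXn mcoeffX.
  by rewrite eqxx mulr1 addr0.
case: eqP => [/mnmP/(_ l)|]; last by rewrite mulr0.
rewrite !mulmnE !mnm1E eqxx eq_sym (negbTE lk) mul1n => n0.
by rewrite n0 in n_gt0.
Qed.

End LocalCoordinates.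

(** * Frobenius powers and their fixed field *)

Lemma mpoly_exprDqX (Fq : finFieldType) (n : nat) (K : fieldType)
    (iota : {rmorphism Fq -> K}) (k : nat) (f g : {mpoly K[n]}) :
  (f + g) ^+ (#|Fq| ^ k) = f ^+ (#|Fq| ^ k) + g ^+ (#|Fq| ^ k).
Proof.
apply: exprDn_pchar; have [p p_pr pF] := finPcharP Fq.
have pR : p \in [pchar {mpoly K[n]}].
  exact: (rmorph_pchar (@mpolyC n K)) (rmorph_pchar iota pF).
by rewrite (eq_pnat _ (pcharf_eq pR)) (card_pprimeChar pF) !pnatX pnat_id.
Qed.

(** X^q - X splits over [Fq] into the factors X - y, so a root in [K] is a root of the image of one
    of them. *)
Lemma frobenius_fixed (Fq : finFieldType) (K : fieldType)
    (iota : {rmorphism Fq -> K}) (x : K) :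
  x ^+ #|Fq| = x -> exists y, x = iota y.
Proof.
move=> xq; have := congr1 (fun f => (map_poly iota f).[x]) (finField_genPoly Fq).
rewrite rmorphB /= map_polyXn map_polyX !hornerE xq subrr.
rewrite rmorph_prod horner_prod => /esym/eqP/prodf_eq0[y _].
rewrite rmorphB /= map_polyX map_polyC !hornerE subr_eq0 => /eqP->.
by exists y.
Qed.

Theorem proposition4p4 (p h q : nat) (p_prime : prime p) (q_def : q = (p ^ h)%N)
    (q_ge3 : (3 <= q)%N)
    (* Fq = F_q, Fq2 = F_(q^2), and K an algebraic closure of F_q *)
    (Fq Fq2 : finFieldType) (card_Fq : #|Fq| = q) (card_Fq2 : #|Fq2| = (q ^ 2)%N)
    (K : closedFieldType) (iota : {rmorphism Fq -> K})
    (K_alg : integralRange iota) (iota2 : {rmorphism Fq2 -> K})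
    (P : 'rV[K]_3) (P_neq0 : P != 0)
    (P_Fq2 : rational_over iota2 P) (P_notFq : ~ rational_over iota P) :
  multiplicity_at (map_mpoly iota (dgz_poly Fq)) P (q - 1).
Proof.
split=> // i Pi0.
pose a j := P 0 j / P 0 i; pose b j := a j ^+ q.
have ai : a i = 1 by rewrite /a divff.
have bi : b i = 1 by rewrite /b ai expr1n.
(* The scalar [c] cancels in a ratio of coordinates, which therefore lies in the image of [Fq2]. *)
have aq2 j : a j ^+ (q ^ 2) = a j.
  have [c [w [c0 Pw]]] := P_Fq2.
  have -> : a j = iota2 (w 0 j / w 0 i).
    by rewrite /a Pw !mxE fmorph_div -mulf_div divff // mul1r.
  by rewrite -rmorphXn -card_Fq2 expf_card.
have ab : exists j, a j != b j.
  (* If a = b, every a_j is fixed by Frobenius, hence lies in F_q, and P = P_i a would be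
     F_q-rational. *)
  apply/existsP; apply: contra_notT P_notFq; rewrite negb_exists => /forallP ab.
  have rat j : {y | a j == iota y}.
    apply/sigW; have [|y ->] := @frobenius_fixed Fq K iota (a j); last by exists y.
    by rewrite card_Fq; apply/esym/eqP/negPn/ab.
  exists (P 0 i), (\row_j sval (rat j)); split=> //.
  apply/rowP => j; rewrite !mxE; case: (rat j) => y /= /eqP <-.
  by rewrite /a mulrC divfK.
have q_gt0 : (0 < q)%N by apply: leq_trans q_ge3.
pose Z := @local_coord K i.
pose phi (f : {mpoly Fq[3]}) : {mpoly K[2]} := local_eq (map_mpoly iota f) P i.
have phiX j k : phi ('X_j ^+ (q ^ k)) = (a j ^+ (q ^ k))%:MP + Z j ^+ (q ^ k).
  rewrite /phi /local_eq !rmorphXn /= map_mpolyX comp_mpolyXU.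
  rewrite -tnth_nth tnth_mktuple -card_Fq -(mpoly_exprDqX iota).
  congr (_ ^+ _); rewrite /Z /local_coord; case: unliftP => [//|->].
  by rewrite ai addr0 mpolyC1.
have phi_det d e : phi (frobenius_det Fq 0 d e) = det3
    (fun j => (a j)%:MP + Z j)
    (fun j => (a j ^+ (q ^ d))%:MP + Z j ^+ (q ^ d))
    (fun j => (a j ^+ (q ^ e))%:MP + Z j ^+ (q ^ e)).
  pose u j k := (a j ^+ (q ^ k))%:MP + Z j ^+ (q ^ k).
  rewrite (@eq_det3 _ _ (u^~ 0%N) _ (u^~ d) _ (u^~ e)) //.
  rewrite -(det_det3 u (nth 0%N [:: 0%N; d; e])) /phi /local_eq -!det_map_mx.
  by congr (\det _); apply/matrixP => j k; rewrite !mxE card_Fq; exact: phiX.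
have Zn n j : (0 < n)%N -> order_ge n (Z j ^+ n).
  by move=> n_gt0; apply/dhomog_order_ge/local_coordX_homog.
have D1P : lowest_degree (phi (D1 Fq)) q.
  rewrite phi_det (@eq_det3 _ _ (fun j => (a j)%:MP + Z j)
    _ (fun j => (b j)%:MP + Z j ^+ q)
    _ (fun j => (b j)%:MP + Z j ^+ (q ^ 3))) //; last first.
    (* a^(q^3) = (a^(q^2))^q = a^q = b. *)
    by move=> j; rewrite (expnD q 2 1) exprM aq2.
  rewrite det3_expand_same23; apply: lowest_degree_decomp.
  - by rewrite rpredN det3_local_homog.
  - by rewrite oppr_eq0 det3_local_neq0.
  (* The two errors have orders at least 1 + q and q^3, both at least q + 1. *)
  apply: order_geD.
    apply/order_geN/(@order_geW _ _ _ (1 + 0 + q)) => //.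
    by apply: order_ge_det3 => // j; [apply: (Zn 1)|apply: Zn].
  apply: (@order_geW _ _ _ (0 + 0 + q ^ 3)); first by rewrite !expnS; nia.
  by apply: order_ge_det3 => // j; apply: Zn; rewrite expn_gt0 q_gt0.
have D2P : lowest_degree (phi (D2 Fq)) 1.
  rewrite phi_det (@eq_det3 _ _ (fun j => (a j)%:MP + Z j)
    _ (fun j => (b j)%:MP + Z j ^+ q)
    _ (fun j => (a j)%:MP + Z j ^+ (q ^ 2))) //; last first.
    by move=> j; rewrite aq2.
  rewrite det3_expand_same13; apply: lowest_degree_decomp.
  (* [Z j ^+ 1] computes to [Z j], so exponent 1 covers the linear form. *)
  - by rewrite rpredN (det3_local_homog i (n := 1)).
  - by rewrite oppr_eq0 (det3_local_neq0 (n := 1)).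
  (* Here the errors have orders at least q + 1 and q^2, both at least 2. *)
  apply: order_geD.
    apply/order_geN/(@order_geW _ _ _ (0 + q + 1)); first by lia.
    by apply: order_ge_det3 => // j; [apply: Zn|apply: (Zn 1)].
  apply: (@order_geW _ _ _ (0 + 0 + q ^ 2)); first by rewrite !expnS; nia.
  by apply: order_ge_det3 => // j; apply: Zn; rewrite expn_gt0 q_gt0.
apply: lowest_degree_factor D2P.
suff <- : phi (D1 Fq) = phi (dgz_poly Fq) * phi (D2 Fq) by [].
by rewrite dgz_polyP /phi /local_eq !rmorphM.
Qed.
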